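(* Consider the continuous-time economic dispatch problem with supply bids $C_k(x_k,t)$ and inflexible load $y(t)$ on $\mathcal T=[t_1,t_2]$, with optimal schedule $x^*=(x_1^*,\dots,x_K^* )$, associated Lagrange multipliers $\lambda^*,\overline\mu_k^*,\underline\mu_k^*,\overline\gamma_k^*,\underline\gamma_k^*$, and such that at every time $t\in\mathcal T$ there is a marginal unit $k^*(t)$ (all terms as defined in the context). Then the surplus-maximizing price for an additional unit of load per unit of time is the Lagrange multiplier $\lambda^*(t)$ of the balance constraint at the optimal schedule, and it equals the marginal cost of the marginal unit. That is, $$\lim_{\epsilon\to 0}\frac{\mathcal L^*(\epsilon)-\mathcal L^*(0)}{\epsilon}=\int_{t_1}^{t_2}\lambda^*(t)\,dt ,$$ and $$\lambda^*(t)=\frac{\partial C_k}{\partial x_k}(x_k^*(t),t)\quad\text{for } k=k^*(t),\ \text{for all } t\in\mathcal T .$$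
   Context: Let $t_1<t_2$, $\mathcal T=[t_1,t_2]$, and let $K\ge 1$ be the number of generating units. The load $y:\mathcal T\to\mathbb R$ is a given continuously differentiable function (inflexible and certain demand). Unit $k$ has a continuously differentiable cost rate $C_k(x,t)$, so that generating the energy $x\,dt$ at time $t$ costs $C_k(x,t)\,dt$. Generation trajectories $x_k:\mathcal T\to\mathbb R$ are continuously differentiable, with no conditions prescribed at the endpoints $t_1,t_2$. Real constants $\underline x_k,\overline x_k$ (capacity limits) and $\underline x_k',\overline x_k'$ (ramping limits) are given. Economic dispatch problem: minimize $\sum_{k=1}^K\int_{t_1}^{t_2}C_k(x_k(t),t)\,dt$ over $x=(x_1,\dots,x_K)$ subject to, for all $t\in\mathcal T$ and all $k$: $\sum_{j=1}^K x_j(t)=y(t)$; $\ x_k(t)-\overline x_k\le 0$; $\ \underline x_k-x_k(t)\le 0$; $\ \dot x_k(t)-\overline x_k'\le 0$; $\ \underline x_k'-\dot x_k(t)\le 0$. Since demand is inflexible, maximizing social surplus means minimizing this cost. Lagrangian: with multiplier functions $\lambda,\overline\mu_k,\underline\mu_k,\overline\gamma_k,\underline\gamma_k$ on $\mathcal T$, $$\mathcal L=\sum_{k=1}^K\int_{t_1}^{t_2}\Big[C_k(x_k,t)+\big(\tfrac{y}{K}-x_k\big)\lambda+\overline\mu_k(x_k-\overline x_k)+\underline\mu_k(\underline x_k-x_k)+\overline\gamma_k(\dot x_k-\overline x_k')+\underline\gamma_k(\underline x_k'-\dot x_k)\Big]dt .$$ Optimal schedule and multipliers: $x^*$ is a (continuously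 differentiable) minimizer of the economic dispatch problem, and the associated Lagrange multipliers $\lambda^*,\overline\mu_k^*,\underline\mu_k^*,\overline\gamma_k^*,\underline\gamma_k^*$ are continuously differentiable functions on $\mathcal T$, assumed to exist, such that the multipliers of the inequality constraints are nonnegative and, with the multipliers fixed at these values, $\mathcal L$ is minimized over all continuously differentiable trajectories $x$ (without constraints) at $x^*$, with minimum value equal to the optimal cost of the dispatch problem. Marginal unit: a unit $k$ is marginal at time $t$, written $k=k^*(t)$, if none of its four inequality constraints (capacity and ramping) is tight at time $t$ along $x^*$. It is assumed throughout that at each $t\in\mathcal T$ there is a marginal unit. Price: $\mathcal L^*(\epsilon)$ denotes the optimal value (infimum of the cost, equivalently the value at optimum) of the dispatch problem in which the load $y(t)$ is replaced by $y(t)+\epsilon$, so $\mathcal L^*(0)$ is the original optimal value. A function $p$ is the price per unit of power and unit of time for a uniform increase of the load if $\lim_{\epsilon\to0}(\mathcal L^*(\epsilon)-\mathcal L^*(0))/\epsilon=\int_{t_1}^{t_2}p(t)\,dt$. *)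

(* Defs.v *)
From mathcomp Require Import all_boot all_order all_algebra.
From mathcomp Require Import all_classical all_reals all_analysis.

Set Implicit Arguments.
Unset Strict Implicit.
Unset Printing Implicit Defensive.

Import Order.TTheory GRing.Theory Num.Theory.
Import numFieldNormedType.Exports.

Local Open Scope classical_set_scope.
Local Open Scope ring_scope.

(* A function on the time interval is represented by a total function R -> R
   of which only the values on the interval matter. Accordingly, derivatives
   are taken relative to a set A: the limit of the difference quotient is over
   s in A, s <> t, hence one-sided at the endpoints of an interval. *)
Definition diff_quotient (R : realType) (f : R -> R) (t s : R) : R :=
  (f s - f t) / (s - t).

Definition derivable_in (R : realType) (A : set R) (f : R -> R) (t : R) : Prop :=
  cvg (diff_quotient f t s @[s --> within A t^']).

Definition deriv_in (R : realType) (A : set R) (f : R -> R) (t : R) : R :=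
  lim (diff_quotient f t s @[s --> within A t^']).

Definition C1_on (R : realType) (A : set R) (f : R -> R) : Prop :=
  (forall t, A t -> derivable_in A f t) /\ {within A, continuous (deriv_in A f)}.

(* Continuous differentiability of (x, t) |-> C x t on R * A: both partial
   derivatives exist there and are jointly continuous. *)
Definition C1_cost (R : realType) (A : set R) (C : R -> R -> R) : Prop :=
  [/\ forall x t, A t -> derivable (C^~ t) x 1,
      forall x t, A t -> derivable_in A (C x) t,
      {within setT `*` A, continuous (fun z : R * R => derive1 (C^~ z.2) z.1)} &
      {within setT `*` A, continuous (fun z : R * R => deriv_in A (C z.1) z.2)}].

(* Everything but the load, which is perturbed when defining the price. *)
Record dispatch (R : realType) (K : nat) := Dispatch {
  t1 : R;
  t2 : R;
  cost : 'I_K -> R -> R -> R; (* cost k x t *)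
  cap_lo : 'I_K -> R;
  cap_hi : 'I_K -> R;
  ramp_lo : 'I_K -> R;
  ramp_hi : 'I_K -> R
}.

Definition horizon (R : realType) (K : nat) (P : dispatch R K) : set R :=
  `[t1 P, t2 P].

Definition rate (R : realType) (K : nat) (P : dispatch R K) (f : R -> R) : R -> R :=
  deriv_in (horizon P) f.

Definition trajectory (R : realType) (K : nat) (P : dispatch R K)
    (x : 'I_K -> R -> R) : Prop :=
  forall k, C1_on (horizon P) (x k).

Definition total_cost (R : realType) (K : nat) (P : dispatch R K)
    (x : 'I_K -> R -> R) : R :=
  \sum_(k < K) \int[lebesgue_measure]_(t in horizon P) cost P k (x k t) t.

Definition feasible (R : realType) (K : nat) (P : dispatch R K) (y : R -> R)
    (x : 'I_K -> R -> R) : Prop :=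
  trajectory P x /\
  forall t, horizon P t ->
    \sum_(j < K) x j t = y t /\
    forall k, [/\ x k t - cap_hi P k <= 0,
                  cap_lo P k - x k t <= 0,
                  rate P (x k) t - ramp_hi P k <= 0 &
                  ramp_lo P k - rate P (x k) t <= 0].

Definition optimal_schedule (R : realType) (K : nat) (P : dispatch R K)
    (y : R -> R) (x : 'I_K -> R -> R) : Prop :=
  feasible P y x /\
  forall z, feasible P y z -> total_cost P x <= total_cost P z.

(* The infimum is taken in \bar R, so that it is +oo when no schedule is
   feasible. *)
Definition optimal_value (R : realType) (K : nat) (P : dispatch R K)
    (y : R -> R) : \bar R :=
  ereal_inf [set (total_cost P x)%:E | x in feasible P y].

Definition shifted_value (R : realType) (K : nat) (P : dispatch R K)
    (y : R -> R) (e : R) : \bar R :=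
  optimal_value P (fun t => y t + e).

Record multipliers (R : realType) (K : nat) := Multipliers {
  lambda : R -> R;
  mu_hi : 'I_K -> R -> R;
  mu_lo : 'I_K -> R -> R;
  gamma_hi : 'I_K -> R -> R;
  gamma_lo : 'I_K -> R -> R
}.

Definition lagrangian (R : realType) (K : nat) (P : dispatch R K) (y : R -> R)
    (m : multipliers R K) (x : 'I_K -> R -> R) : R :=
  \sum_(k < K) \int[lebesgue_measure]_(t in horizon P)
    (cost P k (x k t) t
     + (y t / K%:R - x k t) * lambda m t
     + mu_hi m k t * (x k t - cap_hi P k)
     + mu_lo m k t * (cap_lo P k - x k t)
     + gamma_hi m k t * (rate P (x k) t - ramp_hi P k)
     + gamma_lo m k t * (ramp_lo P k - rate P (x k) t)).

Definition C1_multipliers (R : realType) (K : nat) (P : dispatch R K)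
    (m : multipliers R K) : Prop :=
  C1_on (horizon P) (lambda m) /\
  forall k, [/\ C1_on (horizon P) (mu_hi m k), C1_on (horizon P) (mu_lo m k),
                C1_on (horizon P) (gamma_hi m k) &
                C1_on (horizon P) (gamma_lo m k)].

Definition nonneg_multipliers (R : realType) (K : nat) (P : dispatch R K)
    (m : multipliers R K) : Prop :=
  forall k t, horizon P t ->
    [/\ 0 <= mu_hi m k t, 0 <= mu_lo m k t,
        0 <= gamma_hi m k t & 0 <= gamma_lo m k t].

Definition associated_multipliers (R : realType) (K : nat) (P : dispatch R K)
    (y : R -> R) (x : 'I_K -> R -> R) (m : multipliers R K) : Prop :=
  [/\ C1_multipliers P m,
      nonneg_multipliers P m,
      forall z, trajectory P z -> lagrangian P y m x <= lagrangian P y m z &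
      (lagrangian P y m x)%:E = optimal_value P y].

Definition marginal (R : realType) (K : nat) (P : dispatch R K)
    (x : 'I_K -> R -> R) (k : 'I_K) (t : R) : Prop :=
  [/\ x k t - cap_hi P k <> 0,
      cap_lo P k - x k t <> 0,
      rate P (x k) t - ramp_hi P k <> 0 &
      ramp_lo P k - rate P (x k) t <> 0].

(* p is the price per unit of power and unit of time for a uniform increase of
   the load y. Convergence to a real limit forces the values to be finite for
   small e. *)
Definition is_price (R : realType) (K : nat) (P : dispatch R K) (y : R -> R)
    (p : R -> R) : Prop :=
  ((shifted_value P y e - shifted_value P y 0%R) * (e^-1)%:E)%E @[e --> (0 : R)^']
    --> (\int[lebesgue_measure]_(t in horizon P) p t)%:E.

(* Main.v *)
Require Import Defs.
From mathcomp Require Import all_boot all_order all_algebra.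
From mathcomp Require Import all_classical all_reals all_analysis.
From mathcomp Require Import ring lra.

Import Order.TTheory GRing.Theory Num.Theory.
Import numFieldNormedType.Exports.

Local Open Scope classical_set_scope.
Local Open Scope ring_scope.

(** Since the Lagrangian at the optimum equals the optimal cost, the multiplier
    terms, which are continuous and nonpositive, integrate to zero; hence they
    vanish pointwise (complementary slackness). Let phi be a direction at rest
    wherever some constraint has small slack. Along x + s phi the multiplier
    terms stay zero, so minimality of the Lagrangian for both signs of s gives
    sum_k int (dC_k/dx) phi_k = int (sum_k phi_k) lambda. A bump supported where
    unit k is marginal gives lambda = dC_k/dx. For the price, compactness yields
    a partition of unity phi, whose components are supported, with a uniform
    margin, where the corresponding units are marginal: x + e phi is feasible
    for the load y + e, so the optimal value is at most V + e int lambda + o(e),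
    while weak duality bounds it below by V + e int lambda. *)

(** * Continuity relative to a subset of the line *)

Lemma within_continuousP (R : realType) (A : set R) (f : R -> R) :
  {within A, continuous f} <->
  forall t, A t -> forall e, 0 < e -> exists2 r : R, 0 < r &
    forall u, A u -> `|u - t| < r -> `|f u - f t| <= e.
Proof.
rewrite subspace_continuousP; split=> [h t At e e0|h t At].
  move: (h t At) => /cvgrPdist_le /(_ e e0).
  move=> [r /= r0 hr]; exists r => // u Au ur.
  by rewrite distrC; apply: hr => //=; rewrite distrC.
apply/cvgrPdist_le => e e0; have [r r0 hr] := h t At e e0.
exists r => //= u; rewrite /ball/= => ur Au.
by rewrite distrC; apply: hr => //; rewrite distrC.
Qed.

Section WithinContinuous.
Context {R : realType} {A : set R}.
Implicit Types f g : R -> R.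

Lemma within_continuous_cst (c : R) : {within A, continuous (fun _ : R => c)}.
Proof. by move=> t; exact: cst_continuous. Qed.

Lemma within_continuousM f g : {within A, continuous f} ->
  {within A, continuous g} -> {within A, continuous (fun t => f t * g t)}.
Proof. by move=> cf cg t; apply: continuousM; [exact: cf|exact: cg]. Qed.

Lemma within_continuous_min f g : {within A, continuous f} ->
  {within A, continuous g} ->
  {within A, continuous (fun t => Num.min (f t) (g t))}.
Proof.
move=> cf cg t; apply: (@continuous_min R (subspace A) f g).
  exact: cf.
exact: cg.
Qed.

Lemma within_continuousDf f g : {within A, continuous f} ->
  {within A, continuous g} -> {within A, continuous (fun t => f t + g t)}.
Proof. by move=> cf cg t; apply: continuousD; [exact: cf|exact: cg]. Qed.

Lemma within_continuousBf f g : {within A, continuous f} ->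
  {within A, continuous g} -> {within A, continuous (fun t => f t - g t)}.
Proof. by move=> cf cg t; apply: continuousB; [exact: cf|exact: cg]. Qed.

Lemma within_continuous_abs f : {within A, continuous f} ->
  {within A, continuous (fun t => `|f t|)}.
Proof.
move=> /within_continuousP cf; apply/within_continuousP => t At e e0.
have [r r0 hr] := cf t At e e0; exists r => // u Au ur.
by apply: le_trans (hr u Au ur); exact: ler_dist_dist.
Qed.

Lemma within_continuous_sum (I : Type) (s : seq I) (p : pred I)
    (f : I -> R -> R) :
  (forall i, p i -> {within A, continuous (f i)}) ->
  {within A, continuous (fun t => \sum_(i <- s | p i) f i t)}.
Proof.
move=> cf; elim: s => [|i s ih].
  have -> : (fun t => \sum_(i <- [::] | p i) f i t) = cst 0.
    by apply/funext => t; rewrite big_nil.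
  exact: within_continuous_cst.
have -> : (fun t => \sum_(j <- i :: s | p j) f j t) = fun t => if p i
    then f i t + \sum_(j <- s | p j) f j t else \sum_(j <- s | p j) f j t.
  by apply/funext => t; rewrite big_cons.
by case: (boolP (p i)) => // pi; apply: within_continuousDf => //; exact: cf.
Qed.

End WithinContinuous.

(** * Integrals of continuous functions on a segment *)

Section SegmentIntegral.
Context {R : realType} {a b : R}.
Local Notation T := (`[a, b]%classic : set R).
Local Notation integral f :=
  (\int[lebesgue_measure]_(t in T) f t).
Implicit Types f g : R -> R.

Lemma segment_integrable f : {within T, continuous f} ->
  lebesgue_measure.-integrable T (EFin \o f).
Proof. exact: continuous_compact_integrable (@segment_compact _ _ _). Qed.

Lemma segment_integralD f g : {within T, continuous f} ->
  {within T, continuous g} ->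
  integral (fun t => f t + g t) = integral f + integral g.
Proof. by move=> cf cg; rewrite RintegralD//; exact: segment_integrable. Qed.

Lemma segment_integralB f g : {within T, continuous f} ->
  {within T, continuous g} ->
  integral (fun t => f t - g t) = integral f - integral g.
Proof. by move=> cf cg; rewrite RintegralB//; exact: segment_integrable. Qed.

Lemma segment_integralZ c f : {within T, continuous f} ->
  integral (fun t => c * f t) = c * integral f.
Proof. by move=> cf; rewrite RintegralZl//; exact: segment_integrable. Qed.

Lemma segment_integral_sum (I : Type) (s : seq I) (p : pred I)
    (f : I -> R -> R) :
  (forall i, p i -> {within T, continuous (f i)}) ->
  integral (fun t => \sum_(i <- s | p i) f i t) =
  \sum_(i <- s | p i) integral (f i).
Proof.
move=> cf; elim: s => [|i s ih].
  rewrite big_nil; under eq_Rintegral do rewrite big_nil.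
  by rewrite Rintegral_cst// mul0r.
rewrite big_cons -ih; under eq_Rintegral do rewrite big_cons.
case: ifP => // pi; rewrite segment_integralD//; first exact: cf.
exact: within_continuous_sum.
Qed.

Lemma segment_integral_le f g : {within T, continuous f} ->
  {within T, continuous g} -> (forall t, T t -> f t <= g t) ->
  integral f <= integral g.
Proof. by move=> cf cg fg; apply: le_Rintegral => //; exact: segment_integrable. Qed.

Lemma segment_integral_eq f g : (forall t, T t -> f t = g t) ->
  integral f = integral g.
Proof. by move=> fg; apply: eq_Rintegral => t /set_mem; exact: fg. Qed.

Lemma segment_integral0 f : (forall t, T t -> f t = 0) -> integral f = 0.
Proof. by move=> f0; rewrite (segment_integral_eq _ _ f0) Rintegral_cst// mul0r. Qed.

Lemma segment_integral_abs_le (e : R) f : a <= b -> {within T, continuous f} ->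
  (forall t, T t -> `|f t| <= e) -> `|integral f| <= e * (b - a).
Proof.
move=> ab cf fe; apply: le_trans (le_normr_Rintegral _ _) _ => //.
  exact: segment_integrable.
have -> : e * (b - a) = integral (fun=> e).
  rewrite Rintegral_cst//=.
  rewrite lebesgue_measure_itv/= lte_fin.
  by case: ltgtP ab => //= -> _; rewrite subrr.
apply: segment_integral_le => //; first exact: within_continuous_abs.
exact: within_continuous_cst.
Qed.

(** If f t were positive, f would be at least f t / 2 on a nondegenerate segment around t inside T,
    and the integral would be positive. *)
Lemma segment_integral_eq0 f : a < b -> {within T, continuous f} ->
  (forall t, T t -> 0 <= f t) -> integral f = 0 -> forall t, T t -> f t = 0.
Proof.
move=> ab cf f0 if0 t Tt; apply/eqP; rewrite eq_le f0// andbT leNgt.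
apply/negP => ft0; move: (cf) => /within_continuousP /(_ t Tt (f t / 2)).
rewrite divr_gt0// => /(_ isT) [r r0 hr].
(* Clipping to T keeps c < d even when t is an endpoint, because a < b. *)
pose c := Num.max a (t - r / 2); pose d := Num.min b (t + r / 2).
have /andP[at' tb] : a <= t <= b by move: Tt; rewrite /= in_itv.
have cd : c < d by rewrite /c /d gt_max !lt_min; apply/and3P; split; lra.
have sub : `[c, d]%classic `<=` T.
  move=> u /=; rewrite !in_itv/= /c /d ge_max le_min => /andP[/andP[-> _]].
  by move=> /andP[-> _].
have fcd u : `[c, d]%classic u -> f t / 2 <= f u.
  move=> cdu; have Tu := sub u cdu; have := hr u Tu.
  move: cdu => /=; rewrite in_itv/= /c /d ge_max le_min.
  move=> /andP[/andP[_ h1] /andP[_ h2]].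
  rewrite ltr_norml ler_norml => h.
  have /h/andP[h3 _] : - r < u - t < r by apply/andP; split; lra.
  lra.
suff : 0 < integral f by rewrite if0 ltxx.
have ifin : (\int[lebesgue_measure]_(u in T) (f u)%:E \is a fin_num)%E.
  by apply: integrable_fin_num => //; exact: segment_integrable.
rewrite /Rintegral -lte_fin fineK; last exact: ifin.
apply: (@lt_le_trans _ _ (\int[lebesgue_measure]_(u in `[c, d]) (f u)%:E)%E).
  apply: (@lt_le_trans _ _ (\int[lebesgue_measure]_(u in `[c, d]) (f t / 2)%:E)%E).
    rewrite integral_cst//= lebesgue_measure_itv/= lte_fin cd -EFinB -EFinM lte_fin.
    by rewrite mulr_gt0 ?divr_gt0// subr_gt0.
  apply: ge0_le_integral => //.
  - by move=> u _; rewrite lee_fin ltW// divr_gt0.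
  - apply: (measurable_funS _ sub) => //.
    by have /integrableP[] := segment_integrable f cf.
apply: ge0_subset_integral => //.
by have /integrableP[] := segment_integrable f cf.
Qed.

End SegmentIntegral.

(** * Derivatives on a segment and quadratic splines *)
Local Notation is_deriv_in A f t l :=
  (diff_quotient f t s @[s --> within A t^'] --> (l : _)).

(** Multiplying out the quotient gives a condition that is trivial at s = t, so the punctured
    neighbourhood disappears. *)
Lemma is_deriv_inP (R : realType) (A : set R) (f : R -> R) (t l : R) :
  is_deriv_in A f t l <->
  forall e : R, 0 < e -> exists2 r : R, 0 < r &
    forall s, A s -> `|s - t| < r ->
      `|f s - f t - l * (s - t)| <= e * `|s - t|.
Proof.
have E s : s != t ->
    `|l - diff_quotient f t s| * `|s - t| = `|f s - f t - l * (s - t)|.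
  rewrite -subr_eq0 => st; rewrite -normrM distrC; congr (`| _ |).
  by rewrite mulrBl /diff_quotient mulfVK.
split=> [/cvgrPdist_le h e e0|h].
  have [r /= r0 hr] := h e e0; exists r => // s As sr.
  have [->|st] := eqVneq s t; first by rewrite !subrr mulr0 subr0 normr0 mulr0.
  rewrite -E// ler_wpM2r//; apply: hr => //=.
  by rewrite distrC.
apply/cvgrPdist_le => e e0; have [r r0 hr] := h e e0.
exists r => //= s; rewrite /ball/= => sr st As.
rewrite distrC in sr; have := hr s As sr; rewrite -E// ler_pM2r//.
by rewrite normr_gt0 subr_eq0.
Qed.

Section SegmentDerivative.
Context {R : realType} {a b : R}.
Hypothesis ab : a < b.
Local Notation T := (`[a, b]%classic : set R).
Implicit Types f g : R -> R.

(** Each point of a nondegenerate segment is an accumulation point of it, which makes the limit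
    defining [deriv_in] unique. *)
Lemma segment_dnbhs_proper t : T t -> ProperFilter (within T t^').
Proof.
rewrite /= in_itv/= => /andP[at' tb].
apply: Build_ProperFilter => empty.
have [r r0 h] : exists2 r : R, 0 < r &
    forall s, `|t - s| < r -> s != t -> ~ T s.
  by case: empty => r /= r0 hr; exists r => // s sr st Ts; exact: (hr s sr st Ts).
(* Move to the right of t, or to the left when t = b. *)
have [tb'|bt] := ltP t b.
  pose s := Num.min b (t + r / 2).
  have s1 : s <= b by rewrite /s ge_min lexx.
  have s2 : s <= t + r / 2 by rewrite /s ge_min lexx orbT.
  have s3 : t < s by rewrite /s lt_min tb'/= ltrDl divr_gt0.
  apply: (h s); last by rewrite /= in_itv/= s1 andbT (le_trans at')// ltW.
    rewrite ltr_norml; apply/andP; split; lra.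
  by rewrite gt_eqF.
pose s := Num.max a (t - r / 2).
have s1 : a <= s by rewrite /s le_max lexx.
have s2 : t - r / 2 <= s by rewrite /s le_max lexx orbT.
have s3 : s < t by rewrite /s gt_max; apply/andP; split; [exact: lt_le_trans ab bt|lra].
apply: (h s); last by rewrite /= in_itv/= s1/= (le_trans _ tb)// ltW.
  rewrite ltr_norml; apply/andP; split; lra.
by rewrite lt_eqF.
Qed.

Lemma is_deriv_in_lim f t l : T t -> is_deriv_in T f t l -> deriv_in T f t = l.
Proof.
by move=> Tt fl; have pf := segment_dnbhs_proper t Tt; exact: cvg_lim.
Qed.

Lemma is_deriv_in_lin f g c t l l' :
  is_deriv_in T f t l -> is_deriv_in T g t l' ->
  is_deriv_in T (fun s => f s + c * g s) t (l + c * l').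
Proof.
move=> fl gl.
have -> : diff_quotient (fun s => f s + c * g s) t =
    (fun s => diff_quotient f t s + c * diff_quotient g t s).
  by apply/funext => s; rewrite /diff_quotient mulrA -mulrDl; congr (_ / _); ring.
by apply: cvgD => //; apply: cvgMl_tmp.
Qed.

Lemma C1_onP f f' : (forall t, T t -> is_deriv_in T f t (f' t)) ->
  {within T, continuous f'} ->
  C1_on T f /\ forall t, T t -> deriv_in T f t = f' t.
Proof.
move=> ff' cf'; have E t : T t -> deriv_in T f t = f' t.
  by move=> Tt; apply: is_deriv_in_lim => //; exact: ff'.
split=> //; split; first by move=> t Tt; apply/cvg_ex; exists (f' t); exact: ff'.
apply: subspace_eq_continuous cf' => t; rewrite inE => Tt.
exact/esym/E.
Qed.

Lemma C1_on_lin f g c : C1_on T f -> C1_on T g ->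
  C1_on T (fun t => f t + c * g t) /\
  forall t, T t ->
    deriv_in T (fun t => f t + c * g t) t = deriv_in T f t + c * deriv_in T g t.
Proof.
move=> [df cf] [dg cg]; apply: C1_onP.
  by move=> t Tt; apply: is_deriv_in_lin; [exact: df|exact: dg].
apply: within_continuousDf => //; apply: within_continuousM => //.
exact: within_continuous_cst.
Qed.

Lemma C1_on0 : C1_on T (fun=> 0) /\ forall t, T t -> deriv_in T (fun=> 0) t = 0.
Proof.
apply: C1_onP => [t Tt|]; last exact: within_continuous_cst.
apply/is_deriv_inP => e e0; exists 1 => // s Ts _.
by rewrite !mul0r !subr0 normr0 mulr_ge0// ltW.
Qed.

Lemma derivable_in_continuous f : (forall t, T t -> derivable_in T f t) ->
  {within T, continuous f}.
Proof.
move=> df; apply/within_continuousP => t Tt e e0.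
have /is_deriv_inP /(_ 1 ltr01) [r r0 hr] := df t Tt.
set l := lim _ in hr.
(* Differentiability with tolerance 1 bounds the increment of f by M times that of its argument. *)
pose M := 1 + `|l|; have M0 : 0 < M by rewrite ltr_wpDr.
exists (Num.min r (e / M)); first by rewrite lt_min r0 divr_gt0.
move=> u Tu; rewrite lt_min => /andP[ur ue].
have := hr u Tu ur; rewrite mul1r => h.
have -> : f u - f t = (f u - f t - l * (u - t)) + l * (u - t) by rewrite subrK.
apply: le_trans (ler_normD _ _) _; rewrite normrM.
move: ue; rewrite ltr_pdivlMr// => ue.
by apply: le_trans (ltW ue); rewrite /M [leRHS]mulrDr mulr1 [`|l| * _]mulrC lerD2r.
Qed.

Lemma C1_on_continuous f : C1_on T f -> {within T, continuous f}.
Proof. by case=> df _; exact: derivable_in_continuous. Qed.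

End SegmentDerivative.

(** Building block of the bumps: its square is C^1, with derivative twice itself. *)
Definition pos_part {R : realType} (t : R) : R := Num.max 0 t.

Section Spline.
Context {R : realType} (h c : R).

(* A C^1 bump on [c, c + 4 h]: the difference of two smooth unit steps at
   distance 2 h, so that translates by 2 h telescope to a partition of unity. *)
Definition spline (t : R) : R :=
  (pos_part (t - c) ^+ 2 + - 2 * pos_part (t - (c + h)) ^+ 2
   + 2 * pos_part (t - (c + 3 * h)) ^+ 2
   + - 1 * pos_part (t - (c + 4 * h)) ^+ 2) / (2 * h ^+ 2).

(** The derivative of [spline], piecewise linear for h > 0: up to 1/h at c + h, down to -1/h at c +
    3h, back to 0 at c + 4h. *)
Definition spline' (t : R) : R :=
  (pos_part (t - c) + - 2 * pos_part (t - (c + h))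
   + 2 * pos_part (t - (c + 3 * h)) - pos_part (t - (c + 4 * h))) / h ^+ 2.

Hypothesis h0 : 0 < h.

Lemma pos_partE (t : R) : (t <= 0 /\ pos_part t = 0) \/ (0 <= t /\ pos_part t = t).
Proof.
rewrite /pos_part; case: (leP 0 t) => t0; [right|left] => //.
by split; first exact: ltW.
Qed.

Lemma pos_part_le0 (t : R) : t <= 0 -> pos_part t = 0.
Proof. by move=> t0; rewrite /pos_part; apply/max_idPl. Qed.

Lemma pos_part_ge0 (t : R) : 0 <= t -> pos_part t = t.
Proof. by move=> t0; rewrite /pos_part; apply/max_idPr. Qed.

(** On the left all four positive parts vanish; on the right all four are active and the polynomials
    cancel. *)
Lemma spline_outside (t : R) : t <= c \/ c + 4 * h <= t ->
  spline t = 0 /\ spline' t = 0.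
Proof.
move=> ct; have hp := h0.
have E : (pos_part (t - c) = 0 /\ pos_part (t - (c + h)) = 0 /\
     pos_part (t - (c + 3 * h)) = 0 /\ pos_part (t - (c + 4 * h)) = 0) \/
  (pos_part (t - c) = t - c /\ pos_part (t - (c + h)) = t - (c + h) /\
   pos_part (t - (c + 3 * h)) = t - (c + 3 * h) /\
   pos_part (t - (c + 4 * h)) = t - (c + 4 * h)).
  case: ct => ct; [left|right].
    by rewrite !pos_part_le0; [do !split|lra..].
  by rewrite !pos_part_ge0; [do !split|lra..].
by rewrite /spline /spline'; case: E => -[-> [-> [-> ->]]]; split;
  (rewrite (_ : _ + _ = 0) ?mul0r//); ring.
Qed.

Lemma spline_ge0 (t : R) : 0 <= spline t.
Proof.
have hp := h0; rewrite /spline divr_ge0//; last by rewrite mulr_ge0// sqr_ge0.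
case: (pos_partE (t - c)) => -[? ->]; case: (pos_partE (t - (c + h))) => -[? ->];
case: (pos_partE (t - (c + 3 * h))) => -[? ->];
case: (pos_partE (t - (c + 4 * h))) => -[? ->]; nra.
Qed.

Lemma spline_mid : spline (c + 2 * h) = 1.
Proof.
have hp := h0; rewrite /spline (@pos_part_ge0 (_ - c)); last lra.
rewrite (@pos_part_ge0 (_ - (c + h))); last lra.
rewrite (@pos_part_le0 (_ - (c + 3 * h))); last lra.
rewrite (@pos_part_le0 (_ - (c + 4 * h))); last lra.
by field; rewrite gt_eqF.
Qed.

End Spline.

Section SplineC1.
Context {R : realType} {a b : R}.
Hypothesis ab : a < b.
Local Notation T := (`[a, b]%classic : set R).

Lemma pos_part_lip (s t : R) : `|pos_part s - pos_part t| <= `|s - t|.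
Proof.
case: (pos_partE s) => -[? ->]; case: (pos_partE t) => -[? ->];
by rewrite ler_norml; apply/andP; split; have := ler_norm (s - t);
  have := ler_norm (t - s); rewrite (distrC t s); lra.
Qed.

Lemma pos_part_continuous (c : R) :
  {within T, continuous (fun t => pos_part (t - c))}.
Proof.
apply/within_continuousP => t Tt e e0; exists e => // u _ ut.
apply: le_trans (pos_part_lip _ _) _; apply: ltW.
by rewrite (_ : u - c - (t - c) = u - t)//; ring.
Qed.

Lemma pos_part_sqr_C1 (c : R) : C1_on T (fun t => pos_part (t - c) ^+ 2) /\
  forall t, T t ->
    deriv_in T (fun t => pos_part (t - c) ^+ 2) t = 2 * pos_part (t - c).
Proof.
apply: C1_onP => // [t Tt|]; last first.
  apply: within_continuousM; first exact: within_continuous_cst.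
  exact: pos_part_continuous.
(* The remainder is at most the square of s - t, so the radius e itself works. *)
apply/is_deriv_inP => e e0; exists e => // s _ se.
apply: (@le_trans _ _ (`|s - t| * `|s - t|)); last by rewrite ler_wpM2r// ltW.
rewrite -normrM ger0_norm; last by rewrite -expr2 sqr_ge0.
have -> : s - t = (s - c) - (t - c) by ring.
move: (s - c) (t - c) => u v; rewrite ler_norml.
have := sqr_ge0 (u - v); have := sqr_ge0 v; have := sqr_ge0 u; move=> ? ? ?.
by case: (pos_partE u) => -[? ->]; case: (pos_partE v) => -[? ->];
  apply/andP; split; nra.
Qed.

Lemma C1_onZ f c : C1_on T f -> C1_on T (fun t => c * f t) /\
  forall t, T t -> deriv_in T (fun t => c * f t) t = c * deriv_in T f t.
Proof.
move=> Cf; have [C0 D0] := C1_on0 ab.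
have [C1 D1] := C1_on_lin ab _ _ c C0 Cf.
have E : (fun t => 0 + c * f t) = (fun t => c * f t).
  by apply/funext => t; rewrite add0r.
rewrite E in C1 D1; split=> // t Tt.
by rewrite D1// D0// add0r.
Qed.

Lemma spline_C1 (h c : R) : 0 < h ->
  C1_on T (spline h c) /\ forall t, T t -> deriv_in T (spline h c) t = spline' h c t.
Proof.
move=> h0; have Q := pos_part_sqr_C1.
have [C1 D1] := C1_on_lin ab _ _ (- 2) (Q c).1 (Q (c + h)).1.
have [C2 D2] := C1_on_lin ab _ _ 2 C1 (Q (c + 3 * h)).1.
have [C3 D3] := C1_on_lin ab _ _ (- 1) C2 (Q (c + 4 * h)).1.
have [C4 D4] := C1_onZ _ (2 * h ^+ 2)^-1 C3.
have -> : spline h c = fun t => (2 * h ^+ 2)^-1 *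
  (pos_part (t - c) ^+ 2 + - 2 * pos_part (t - (c + h)) ^+ 2
   + 2 * pos_part (t - (c + 3 * h)) ^+ 2
   + - 1 * pos_part (t - (c + 4 * h)) ^+ 2).
  by apply/funext => t; rewrite mulrC.
split=> // t Tt; rewrite D4// D3// D2// D1// !(Q _).2// /spline'.
by field; rewrite gt_eqF.
Qed.

End SplineC1.

Lemma spline_partition (R : realType) (h c : R) (n : nat) (t : R) : 0 < h ->
  c + 2 * h <= t -> t <= c + 2 * h * n%:R ->
  \sum_(i < n) spline h (c + 2 * h * i%:R) t = 1.
Proof.
move=> h0 ct tn.
(* As a function of t, G d is a C^1 step from 0 to 1 on [d, d + 2h]. Each bump is a difference of
   consecutive steps, so the sum telescopes to the first step, equal to 1 here, minus the last,
   equal to 0. *)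
pose G d := (pos_part (t - d) ^+ 2 - 2 * pos_part (t - (d + h)) ^+ 2
  + pos_part (t - (d + 2 * h)) ^+ 2) / (2 * h ^+ 2).
have E i : spline h (c + 2 * h * i%:R) t =
    - (G (c + 2 * h * i.+1%:R) - G (c + 2 * h * i%:R)).
  rewrite /spline /G -(addn1 i) natrD.
  rewrite (_ : c + 2 * h * (i%:R + 1) + h = c + 2 * h * i%:R + 3 * h); last ring.
  rewrite (_ : c + 2 * h * (i%:R + 1) + 2 * h = c + 2 * h * i%:R + 4 * h);
    last ring.
  rewrite (_ : c + 2 * h * (i%:R + 1) = c + 2 * h * i%:R + 2 * h); last ring.
  by ring.
under eq_bigr do rewrite E.
rewrite sumrN.
rewrite -(big_mkord xpredT (fun i => G (c + 2 * h * i.+1%:R) - G (c + 2 * h * i%:R))).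
rewrite telescope_sumr// mulr0 addr0 opprB /G.
rewrite (@pos_part_ge0 _ (t - c)); last lra.
rewrite (@pos_part_ge0 _ (t - (c + h))); last lra.
rewrite (@pos_part_ge0 _ (t - (c + 2 * h))); last lra.
rewrite !pos_part_le0; [|lra..].
by field; rewrite gt_eqF.
Qed.

(** * Variation of the cost *)
Lemma segment_bounded (R : realType) (a b : R) (f : R -> R) : a <= b ->
  {within `[a, b], continuous f} ->
  exists2 M : R, 0 < M & forall t, `[a, b]%classic t -> `|f t| <= M.
Proof.
move=> ab cf; have [c _ hc] := EVT_max ab (within_continuous_abs _ cf).
(* The added 1 makes the bound positive, so that it can be divided by. *)
exists (1 + `|f c|) => [|t Tt]; first by rewrite ltr_wpDr.
by apply: le_trans (hc t Tt) _; rewrite lerDr.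
Qed.

Section Cost.
Context {R : realType} {a b : R} {C : R -> R -> R}.
Hypothesis ab : a < b.
Local Notation T := (`[a, b]%classic : set R).
Hypothesis C1 : C1_cost T C.
Local Notation dC v t := (derive1 (C^~ t) v).
Local Notation integral f := (\int[lebesgue_measure]_(t in T) f t).
Implicit Types z phi : R -> R.

Lemma marginal_cost_near v t (e : R) : T t -> 0 < e ->
  exists2 r : R, 0 < r & forall w u, T u -> `|w - v| < r -> `|u - t| < r ->
    `|dC w u - dC v t| <= e.
Proof.
move=> Tt e0; case: C1 => _ _ + _; rewrite subspace_continuousP.
move=> /(_ (v, t) (conj I Tt)) /cvgrPdist_le /(_ e e0) /= h.
have [r /= r0 hr] : exists2 r : R, 0 < r & ball (v, t) r `<=`
    [set z | (setT `*` T) z -> `|dC v t - dC z.1 z.2| <= e].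
  by move: h => /nbhs_ballP[r r0 hr]; exists r => // z /hr; exact.
exists r => // w u Tu wr ur; rewrite distrC.
by apply: (hr (w, u)) => //; split; rewrite /ball/= distrC.
Qed.

Lemma cost_mean_value v w t : T t -> exists2 c,
  `|c - w| <= `|v - w| & C v t - C w t = dC c t * (v - w).
Proof.
move=> Tt; case: C1 => dx _ _ _.
have D (x : R) : is_derive x (1 : R) (C^~ t) (dC x t).
  by rewrite derive1E; apply/derivableP; exact: dx.
have Dc : continuous (C^~ t : R -> R).
  by move=> x; apply/differentiable_continuous/derivable1_diffP/dx.
have [vw|wv] := leP v w.
  have [c cvw E] := MVT_segment vw (fun x _ => D x) (continuous_subspaceT Dc).
  exists c; last by rewrite -[LHS]opprB E; ring.
  move: cvw; rewrite in_itv/= => /andP[vc cw].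
  by rewrite !ler0_norm ?subr_le0// lerN2 lerD2r.
have [c cvw E] := MVT_segment (ltW wv) (fun x _ => D x) (continuous_subspaceT Dc).
exists c => //; move: cvw; rewrite in_itv/= => /andP[wc cv].
by rewrite !ger0_norm ?subr_ge0// ?lerD2r// ltW.
Qed.

Lemma marginal_cost_continuous z : {within T, continuous z} ->
  {within T, continuous (fun t => dC (z t) t)}.
Proof.
move=> /within_continuousP cz; apply/within_continuousP => t Tt e e0.
have [r r0 hr] := marginal_cost_near (z t) t e Tt e0.
have [r' r'0 hr'] := cz t Tt (r / 2) (divr_gt0 r0 (ltr0Sn _ 1)).
exists (Num.min r r'); first by rewrite lt_min r0.
move=> u Tu; rewrite lt_min => /andP[ur ur'].
apply: hr => //; have := hr' u Tu ur'; lra.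
Qed.

(** The increment splits into a change of x at fixed time, bounded by the mean value theorem and a
    local bound on the marginal cost, and a change of time at fixed x, small because C is
    differentiable in t. *)
Lemma cost_continuous z : {within T, continuous z} ->
  {within T, continuous (fun t => C (z t) t)}.
Proof.
move=> /within_continuousP cz; apply/within_continuousP => t Tt e e0.
have e20 : 0 < e / 2 by rewrite divr_gt0.
have [r r0 hr] := marginal_cost_near (z t) t 1 Tt ltr01.
pose M := 1 + `|dC (z t) t|; have M0 : 0 < M by rewrite ltr_wpDr.
have /within_continuousP cC : {within T, continuous (C (z t))}.
  by case: C1 => _ dt _ _; apply: derivable_in_continuous => //; exact: dt.
have [r1 r10 hr1] := cC t Tt (e / 2) e20.
(* The first bound keeps the intermediate point where the marginal cost is at most M; the second
   makes M * d at most e / 2. *)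
pose d := Num.min (r / 2) (e / 2 / M).
have d0 : 0 < d by rewrite lt_min !divr_gt0.
have [r2 r20 hr2] := cz t Tt d d0.
exists (Num.min r (Num.min r1 r2)); first by rewrite !lt_min r0 r10.
move=> u Tu; rewrite !lt_min => /and3P[ur ur1 ur2].
have := hr2 u Tu ur2; rewrite le_min => /andP[zr ze].
have [c cz' E] := cost_mean_value (z u) (z t) u Tu.
have cr : `|c - z t| < r by lra.
have dcM : `|dC c u| <= M.
  rewrite -[dC c u](subrK (dC (z t) t)).
  by apply: le_trans (ler_normD _ _) _; rewrite lerD2r; exact: hr.
have -> : C (z u) u - C (z t) t = (C (z u) u - C (z t) u) + (C (z t) u - C (z t) t).
  by ring.
apply: le_trans (ler_normD _ _) _; rewrite [leRHS]splitr lerD//; last exact: hr1.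
rewrite E normrM; apply: (@le_trans _ _ (M * (e / 2 / M))).
  by apply: ler_pM.
by rewrite mulrC divfK// gt_eqF.
Qed.

(* Mean value theorem, with the marginal cost uniformly continuous along the
   graph of [z] by compactness. *)
Lemma cost_expansion z phi (e : R) : {within T, continuous z} ->
  {within T, continuous phi} -> 0 < e ->
  exists2 r : R, 0 < r & forall s : R, `|s| < r -> forall t, T t ->
    `|C (z t + s * phi t) t - C (z t) t - s * (dC (z t) t * phi t)| <= e * `|s|.
Proof.
move=> /within_continuousP cz cphi e0.
have [M M0 hM] := segment_bounded _ _ _ _ (ltW ab) cphi.
have eM : 0 < e / M / 2 by rewrite !divr_gt0.
(* Since M bounds phi, P s t covers every intermediate point between z t and z t + s * phi t. *)
pose P (s t : R) := forall v, `|v - z t| <= `|s| * M ->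
  `|dC v t - dC (z t) t| <= e / M.
have : \forall s \near (0 : R), T `<=` P s.
  have /compact_near_coveringP/near_covering_withinP H := @segment_compact R a b.
  apply: (H R (nbhs (0 : R)) P _) => t Tt.
  have [r r0 hr] := marginal_cost_near (z t) t (e / M / 2) Tt eM.
  have [r' r'0 hr'] := cz t Tt (r / 2) (divr_gt0 r0 (ltr0Sn _ 1)).
  exists (ball t (Num.min r r'), ball 0 (r / 2 / M)).
    by split; apply: nbhsx_ballx; rewrite ?lt_min ?r0// !divr_gt0.
  move=> [u s] /= []; rewrite /ball/= => + + Tu v.
  rewrite lt_min sub0r normrN distrC => /andP[ur ur'] sr vu.
  have zu := hr' u Tu ur'.
  have sM : `|s| * M < r / 2 by rewrite -ltr_pdivlMr.
  have h1 : `|dC v u - dC (z t) t| <= e / M / 2.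
    apply: hr => //; rewrite -[v](subrK (z u)) -addrA.
    by apply: le_lt_trans (ler_normD _ _) _; lra.
  have h2 : `|dC (z u) u - dC (z t) t| <= e / M / 2.
    by apply: hr => //; lra.
  (* Both values at time u are compared with the one at the covering point t, with half the
     tolerance each. *)
  have -> : dC v u - dC (z u) u =
    (dC v u - dC (z t) t) - (dC (z u) u - dC (z t) t) by ring.
  apply: le_trans (ler_normB _ _) _; rewrite [leRHS]splitr.
  exact: lerD.
move=> [r /= r0 hr]; exists r => // s sr t Tt.
have Ps : P s t by apply: hr => //=; rewrite sub0r normrN.
have [c cs E] := cost_mean_value (z t + s * phi t) (z t) t Tt.
have zs : z t + s * phi t - z t = s * phi t by ring.
rewrite E; rewrite zs in cs *.
have -> : dC c t * (s * phi t) - s * (dC (z t) t * phi t) =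
  (dC c t - dC (z t) t) * phi t * s by ring.
rewrite normrM ler_wpM2r// normrM.
rewrite -[leRHS](@divfK _ M) ?gt_eqF//; apply: ler_pM => //; last exact: hM.
by apply: Ps; apply: le_trans cs _; rewrite normrM ler_wpM2l// hM.
Qed.

Lemma integral_cost_expansion z phi (e : R) : {within T, continuous z} ->
  {within T, continuous phi} -> 0 < e ->
  exists2 r : R, 0 < r & forall s : R, `|s| < r ->
    `|integral (fun t => C (z t + s * phi t) t) - integral (fun t => C (z t) t)
      - s * integral (fun t => dC (z t) t * phi t)| <= e * `|s|.
Proof.
move=> cz cphi e0.
have ba : 0 < b - a by rewrite subr_gt0.
(* The tolerance is divided by the length of the segment over which the pointwise error is
   integrated. *)
have [r r0 hr] := cost_expansion z phi (e / (b - a)) cz cphi (divr_gt0 e0 ba).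
exists r => // s sr.
have c0 := cost_continuous z cz.
have c1 : {within T, continuous (fun t => C (z t + s * phi t) t)}.
  apply: cost_continuous; apply: within_continuousDf => //.
  by apply: within_continuousM => //; exact: within_continuous_cst.
have c2 : {within T, continuous (fun t => dC (z t) t * phi t)}.
  by apply: within_continuousM => //; exact: marginal_cost_continuous.
have c3 : {within T, continuous (fun t => s * (dC (z t) t * phi t))}.
  by apply: within_continuousM => //; exact: within_continuous_cst.
have c4 := within_continuousBf _ _ c1 c0.
rewrite -segment_integralZ// -segment_integralB// -segment_integralB//.
apply: le_trans (segment_integral_abs_le (e / (b - a) * `|s|) _ (ltW ab) _ (hr s sr)) _.
  exact: within_continuousBf.
by rewrite mulrAC divfK// gt_eqF.
Qed.

End Cost.

(** * Duality for the dispatch problem *)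
Section Dispatch.
Context {R : realType} {K : nat} {P : dispatch R K}.
Hypothesis ht : t1 P < t2 P.
Local Notation T := (`[t1 P, t2 P]%classic : set R).
Local Notation integral f := (\int[lebesgue_measure]_(t in T) f t).
Implicit Types (x z phi : 'I_K -> R -> R) (y : R -> R) (m : multipliers R K).

(** All four margins in one continuous function, nonnegative on feasible schedules and positive
    where the unit is marginal, so that compactness can make the margin uniform. *)
Definition slack (P : dispatch R K) x k t :=
  Num.min (Num.min (cap_hi P k - x k t) (x k t - cap_lo P k))
    (Num.min (ramp_hi P k - rate P (x k) t) (rate P (x k) t - ramp_lo P k)).

Lemma slack_ge (d : R) x k t : d <= slack P x k t <->
  [/\ d <= cap_hi P k - x k t, d <= x k t - cap_lo P k,
      d <= ramp_hi P k - rate P (x k) t & d <= rate P (x k) t - ramp_lo P k].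
Proof.
rewrite /slack !le_min; split=> [/andP[/andP[? ?] /andP[? ?]]//|[? ? ? ?]].
by apply/andP; split; apply/andP.
Qed.

Lemma trajectory_continuous x k : trajectory P x ->
  {within T, continuous (x k)} /\ {within T, continuous (rate P (x k))}.
Proof. by move=> tx; split; [exact/C1_on_continuous|exact: (tx k).2]. Qed.

Lemma slack_continuous x k : trajectory P x ->
  {within T, continuous (slack P x k)}.
Proof.
move=> /(trajectory_continuous _ k) [cx cr].
by apply: within_continuous_min; apply: within_continuous_min;
  apply: within_continuousBf => //; exact: within_continuous_cst.
Qed.

Lemma feasible_slack_ge0 y x k t : feasible P y x -> T t -> 0 <= slack P x k t.
Proof.
move=> [_ /(_ t) h] /h [_ /(_ k) [? ? ? ?]]; apply/slack_ge; split; lra.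
Qed.

Lemma marginal_slack_gt0 y x k t : feasible P y x -> T t ->
  marginal P x k t -> 0 < slack P x k t.
Proof.
move=> fx Tt [/eqP h1 /eqP h2 /eqP h3 /eqP h4].
have /slack_ge[g1 g2 g3 g4] := feasible_slack_ge0 _ _ k _ fx Tt.
rewrite /slack !lt_min !lt_neqAle g1 g2 g3 g4 !andbT.
by rewrite eq_sym -oppr_eq0 opprB h1 eq_sym -oppr_eq0 opprB h2
  eq_sym -oppr_eq0 opprB h3 eq_sym -oppr_eq0 opprB h4.
Qed.

(* Directions in which [x] can be moved both ways, because they are at rest
   wherever some constraint of the unit has slack less than [d]. *)
Definition direction (P : dispatch R K) x (d : R) phi :=
  trajectory P phi /\
  forall k t, horizon P t -> slack P x k t < d -> phi k t = 0 /\ rate P (phi k) t = 0.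

Lemma perturb_trajectory x phi (s : R) : trajectory P x -> trajectory P phi ->
  trajectory P (fun k t => x k t + s * phi k t) /\
  forall k t, T t -> rate P (fun t => x k t + s * phi k t) t =
    rate P (x k) t + s * rate P (phi k) t.
Proof.
move=> tx tphi; have H k := C1_on_lin ht _ _ s (tx k) (tphi k).
by split=> k; have [] := H k.
Qed.

(** Where the slack of a unit is below d nothing moves; elsewhere a perturbation of levels and rates
    by at most d respects the limits. *)
Lemma perturb_feasible y x (d : R) phi : 0 < d -> feasible P y x ->
  direction P x d phi -> (forall t, T t -> \sum_k phi k t = 1) ->
  exists2 r : R, 0 < r & forall s : R, `|s| < r ->
    feasible P (fun t => y t + s) (fun k t => x k t + s * phi k t).
Proof.
move=> d0 [tx fx] [tphi dphi] phi1.
(* A sum over the units gives one bound M for all levels and rates of phi. *)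
pose B t := \sum_k (`|phi k t| + `|rate P (phi k) t|).
have cB : {within T, continuous B}.
  apply: within_continuous_sum => k _.
  have [c1 c2] := trajectory_continuous _ k tphi.
  by apply: within_continuousDf; apply: within_continuous_abs.
have [M M0 hM] := segment_bounded _ _ _ _ (ltW ht) cB.
have bound k t : T t -> `|phi k t| <= M /\ `|rate P (phi k) t| <= M.
  move=> Tt; have := le_trans (ler_norm _) (hM t Tt).
  rewrite /B (bigD1 k)//=.
  have : 0 <= \sum_(j | j != k) (`|phi j t| + `|rate P (phi j) t|).
    by apply: sumr_ge0 => j _; rewrite addr_ge0.
  have := normr_ge0 (phi k t).
  by have := normr_ge0 (rate P (phi k) t); split; lra.
exists (d / M); first by rewrite divr_gt0.
move=> s; rewrite ltr_pdivlMr// => sM.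
have [tz rz] := perturb_trajectory x phi s tx tphi.
split=> // t Tt; split.
  have [E _] := fx t Tt.
  by rewrite big_split/= E -mulr_sumr phi1// mulr1.
move=> k; rewrite rz//; have [_ /(_ k) [g1 g2 g3 g4]] := fx t Tt.
have [sd|ds] := ltP (slack P x k t) d.
  by have [-> ->] := dphi k t Tt sd; rewrite !mulr0 !addr0.
have /slack_ge[h1 h2 h3 h4] := ds.
have [b1 b2] := bound k t Tt.
have : `|s * phi k t| <= d.
  by apply: le_trans (ltW sM); rewrite normrM ler_wpM2l.
have : `|s * rate P (phi k) t| <= d.
  by apply: le_trans (ltW sM); rewrite normrM ler_wpM2l.
rewrite !ler_norml => /andP[? ?] /andP[? ?]; split; lra.
Qed.

Lemma optimal_valueE y x : optimal_schedule P y x ->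
  optimal_value P y = (total_cost P x)%:E.
Proof.
move=> [fx ox]; apply/eqP; rewrite eq_le; apply/andP; split.
  by apply: ereal_inf_lbound; exists x.
by apply: le_ereal_inf_tmp => _ [z fz <-]; rewrite lee_fin ox.
Qed.

(** The contribution of the inequality constraints of unit k to the integrand of the Lagrangian. *)
Definition penalty (P : dispatch R K) m x k t :=
  mu_hi m k t * (x k t - cap_hi P k) + mu_lo m k t * (cap_lo P k - x k t)
  + gamma_hi m k t * (rate P (x k) t - ramp_hi P k)
  + gamma_lo m k t * (ramp_lo P k - rate P (x k) t).

Lemma penalty_continuous m x k : C1_multipliers P m -> trajectory P x ->
  {within T, continuous (penalty P m x k)}.
Proof.
move=> [_ /(_ k) [m1 m2 m3 m4]] /(trajectory_continuous _ k) [cx cr].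
have c f := @C1_on_continuous R (t1 P) (t2 P) f.
have cc (e : R) := @within_continuous_cst R T e.
by do !apply: within_continuousDf; apply: within_continuousM; try exact: c;
  apply: within_continuousBf.
Qed.

Lemma penalty_le0 m y x k t : nonneg_multipliers P m -> feasible P y x -> T t ->
  [/\ mu_hi m k t * (x k t - cap_hi P k) <= 0,
      mu_lo m k t * (cap_lo P k - x k t) <= 0,
      gamma_hi m k t * (rate P (x k) t - ramp_hi P k) <= 0 &
      gamma_lo m k t * (ramp_lo P k - rate P (x k) t) <= 0].
Proof.
move=> nm [_ fx] Tt; have [? ? ? ?] := nm k t Tt.
by have [_ /(_ k) [? ? ? ?]] := fx t Tt; split; apply: mulr_ge0_le0.
Qed.

Section Cost.
Hypothesis hC : forall k, C1_cost (horizon P) (cost P k).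

Lemma cost_along_continuous x k : trajectory P x ->
  {within T, continuous (fun t => cost P k (x k t) t)}.
Proof.
move=> /(trajectory_continuous _ k) [cx _].
exact: (cost_continuous (hC k)).
Qed.

(** The K shares y / K add up to y, which gathers the balance terms into one integral. *)
Lemma lagrangianE y m x : (0 < K)%N -> {within T, continuous y} ->
  C1_multipliers P m -> trajectory P x ->
  lagrangian P y m x = total_cost P x
    + integral (fun t => (y t - \sum_k x k t) * lambda m t)
    + \sum_k integral (penalty P m x k).
Proof.
move=> K0 cy Cm tx.
have cl := C1_on_continuous _ Cm.1.
have cb k : {within T, continuous (fun t => (y t / K%:R - x k t) * lambda m t)}.
  apply: within_continuousM => //; apply: within_continuousBf.
    by apply: within_continuousM => //; exact: within_continuous_cst.
  by have [] := trajectory_continuous _ k tx.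
have -> : integral (fun t => (y t - \sum_k x k t) * lambda m t) =
    \sum_k integral (fun t => (y t / K%:R - x k t) * lambda m t).
  rewrite -segment_integral_sum//; apply: segment_integral_eq => t _.
  rewrite -mulr_suml sumrB sumr_const card_ord -(mulr_natr (y t / _)) divfK//.
  by rewrite pnatr_eq0 -lt0n.
rewrite /lagrangian /total_cost -!big_split/=; apply: eq_bigr => k _.
have c1 := cost_along_continuous x k tx.
have c2 := penalty_continuous m x k Cm tx.
rewrite -segment_integralD// -segment_integralD//; last exact: within_continuousDf.
by apply: segment_integral_eq => t _; rewrite /penalty !addrA.
Qed.

(** * Consequences of optimality *)

Section Optimum.
Context {y : R -> R} {x : 'I_K -> R -> R} {m : multipliers R K}.
Hypothesis hK : (1 <= K)%N.
Hypothesis hy : C1_on (horizon P) y.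
Hypothesis hx : optimal_schedule P y x.
Hypothesis hm : associated_multipliers P y x m.

Let tx : trajectory P x. Proof. by case: hx => -[]. Qed.

Lemma lambda_continuous : {within T, continuous (lambda m)}.
Proof. by case: hm => -[Cl _] _ _ _; exact: C1_on_continuous. Qed.

Lemma load_continuous : {within T, continuous y}.
Proof. exact: C1_on_continuous. Qed.

Lemma lagrangian_optimum : lagrangian P y m x = total_cost P x.
Proof.
by case: hm => _ _ _; rewrite (optimal_valueE _ _ hx) => -[].
Qed.

(** In the Lagrangian of the original load y, a schedule z for the load y + e has balance term -e
    times the integral of lambda and nonpositive penalties; the minimum of the Lagrangian is the
    optimal cost. *)
Lemma weak_duality z (e : R) : feasible P (fun t => y t + e) z ->
  total_cost P x + e * integral (lambda m) <= total_cost P z.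
Proof.
move=> fz; have [Cm nm /(_ z fz.1) Lmin _] := hm.
move: Lmin; rewrite lagrangian_optimum lagrangianE//; [|exact: load_continuous|exact: fz.1].
have -> : integral (fun t => (y t - \sum_k z k t) * lambda m t) =
    - e * integral (lambda m).
  rewrite -segment_integralZ; last exact: lambda_continuous.
  apply: segment_integral_eq => t Tt; have [-> _] := fz.2 t Tt.
  by congr (_ * _); ring.
have : \sum_k integral (penalty P m z k) <= 0.
  apply: sumr_le0 => k _.
  have <- : integral (fun=> 0) = 0 by exact: segment_integral0.
  apply: segment_integral_le; [|exact: within_continuous_cst|].
    exact: penalty_continuous Cm fz.1.
  move=> t Tt; have [? ? ? ?] := penalty_le0 _ _ _ k _ nm fz Tt.
  by rewrite /penalty; lra.
lra.
Qed.

(** At x the Lagrangian equals the cost and the balance term vanishes, so the penalties have total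
    integral 0. Being nonpositive and continuous, each vanishes pointwise, and so does each of its
    four nonpositive terms. *)
Lemma complementary_slackness k t : T t ->
  [/\ mu_hi m k t * (x k t - cap_hi P k) = 0,
      mu_lo m k t * (cap_lo P k - x k t) = 0,
      gamma_hi m k t * (rate P (x k) t - ramp_hi P k) = 0 &
      gamma_lo m k t * (ramp_lo P k - rate P (x k) t) = 0].
Proof.
move=> Tt; have [Cm nm _ _] := hm.
have cp j := penalty_continuous m x j Cm tx.
have p0 j s : T s -> 0 <= -1 * penalty P m x j s.
  move=> Ts; have [? ? ? ?] := penalty_le0 _ _ _ j _ nm hx.1 Ts.
  by rewrite /penalty; lra.
have cn j : {within T, continuous (fun s => -1 * penalty P m x j s)}.
  by apply: within_continuousM => //; exact: within_continuous_cst.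
have sum0 : \sum_j integral (fun s => -1 * penalty P m x j s) = 0.
  have := lagrangian_optimum; rewrite lagrangianE//; last exact: load_continuous.
  have -> : integral (fun t => (y t - \sum_k x k t) * lambda m t) = 0.
    apply: segment_integral0 => s Ts.
    by have [-> _] := hx.1.2 s Ts; rewrite subrr mul0r.
  have -> : \sum_j integral (fun s => -1 * penalty P m x j s) =
      -1 * \sum_j integral (penalty P m x j).
    by rewrite mulr_sumr; apply: eq_bigr => j _; rewrite segment_integralZ.
  lra.
have int0 : integral (fun s => -1 * penalty P m x k s) = 0.
  apply/eqP; move: sum0 => /eqP; rewrite psumr_eq0.
    by move=> /allP /(_ k); rewrite mem_index_enum => /(_ isT).
  by move=> j _; apply: Rintegral_ge0; exact: p0.
have := segment_integral_eq0 _ ht (cn k) (p0 k) int0 t Tt.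
have [? ? ? ?] := penalty_le0 _ _ _ k _ nm hx.1 Tt.
by rewrite /penalty => ?; split; lra.
Qed.

(** Where the slack is below d, phi is at rest and the terms are those of x. Elsewhere no constraint
    is tight, so the four multipliers vanish. *)
Lemma penalty_perturb (d : R) phi (s : R) k t : 0 < d -> direction P x d phi ->
  T t -> penalty P m (fun k t => x k t + s * phi k t) k t = 0.
Proof.
move=> d0 [tphi dphi] Tt.
have [_ rz] := perturb_trajectory x phi s tx tphi.
have [c1 c2 c3 c4] := complementary_slackness k t Tt.
rewrite /penalty rz//.
have [sd|/slack_ge[h1 h2 h3 h4]] := ltP (slack P x k t) d.
  by have [-> ->] := dphi k t Tt sd; rewrite !mulr0 !addr0 c1 c2 c3 c4 !addr0.
have z (u v : R) : d <= - v -> u * v = 0 -> u = 0.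
  by move=> dv /eqP; rewrite mulf_eq0 => /orP[/eqP//|/eqP v0]; move: dv; lra.
rewrite (z _ _ _ c1); last lra.
rewrite (z _ _ _ c2); last lra.
rewrite (z _ _ _ c3); last lra.
rewrite (z _ _ _ c4); last lra.
by rewrite !mul0r !addr0.
Qed.

Local Notation marginal_cost k t := (derive1 (fun v => cost P k v t) (x k t)).

Lemma total_cost_expansion phi (e : R) : trajectory P phi -> 0 < e ->
  exists2 r : R, 0 < r & forall s : R, `|s| < r ->
    `|total_cost P (fun k t => x k t + s * phi k t) - total_cost P x
      - s * \sum_k integral (fun t => marginal_cost k t * phi k t)| <= e * `|s|.
Proof.
move=> tphi e0.
(* Each unit receives an equal share of the tolerance; the smallest of the radii, capped at 1,
   serves all units. *)
have eK : 0 < e / K%:R by rewrite divr_gt0// ltr0n.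
have H k := integral_cost_expansion ht (hC k) _ _ _
  (trajectory_continuous _ k tx).1 (trajectory_continuous _ k tphi).1 eK.
pose r k := sval (cid2 (H k)).
exists (\big[Num.min/1]_k r k).
  by apply: lt_bigmin => // k _; rewrite /r; case: cid2.
move=> s sr; rewrite mulr_sumr /total_cost -!sumrB.
apply: le_trans (ler_norm_sum _ _ _) _.
have -> : e * `|s| = \sum_(k < K) (e / K%:R * `|s|).
  rewrite sumr_const card_ord -[_ *+ K]mulr_natr mulrAC divfK//.
  by rewrite pnatr_eq0 -lt0n.
apply: ler_sum => k _.
have srk : `|s| < r k by apply: lt_le_trans sr _; exact: bigmin_le.
move: srk; rewrite /r; case: cid2 => /= r0 _ hr srk; exact: hr s srk.
Qed.

(** The cost increment minus s * L is nonnegative for every s of either sign, and equals s * (D - L)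
    up to o(s); hence D = L. *)
Lemma stationarity (d : R) phi : 0 < d -> direction P x d phi ->
  \sum_k integral (fun t => marginal_cost k t * phi k t) =
  integral (fun t => (\sum_k phi k t) * lambda m t).
Proof.
move=> d0 dphi; have tphi := dphi.1.
set D := LHS; set L := RHS.
have cs : {within T, continuous (fun t => (\sum_k phi k t) * lambda m t)}.
  apply: within_continuousM; last exact: lambda_continuous.
  by apply: within_continuous_sum => k _; have [] := trajectory_continuous _ k tphi.
have [Cm nm Lmin _] := hm.
have ge s : 0 <= total_cost P (fun k t => x k t + s * phi k t) - total_cost P x
    - s * L.
  have [tz _] := perturb_trajectory x phi s tx tphi.
  have := Lmin _ tz; rewrite lagrangian_optimum lagrangianE//; last exact: load_continuous.
  rewrite [X in _ + X]big1 => [|k _]; last first.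
    by apply: segment_integral0 => t Tt; exact: (penalty_perturb d).
  have -> : integral (fun t => (y t - \sum_k (x k t + s * phi k t)) * lambda m t)
      = - s * L.
    rewrite -segment_integralZ//; apply: segment_integral_eq => t Tt.
    rewrite big_split/= (hx.1.2 t Tt).1 -mulr_sumr; ring.
  lra.
have main e : 0 < e -> `|D - L| <= e.
  move=> e0; have [r r0 hr] := total_cost_expansion phi e tphi e0.
  have r20 : 0 < r / 2 by rewrite divr_gt0.
  have h1 : `|r / 2| < r by rewrite gtr0_norm//; lra.
  have h2 : `|- (r / 2)| < r by rewrite normrN.
  have := hr _ h1; have := ge (r / 2); have := hr _ h2; have := ge (- (r / 2)).
  rewrite normrN (gtr0_norm r20) -/D !ler_norml => a1 /andP[a2 a3] a4 /andP[a5 a6].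
  (* The increment s = r / 2 bounds D - L from below, and s = - (r / 2) from above. *)
  by apply/andP; split; rewrite -(ler_pM2r r20); lra.
apply/eqP; rewrite -subr_eq0 -normr_le0; apply/ler_addgt0Pr => e e0.
by rewrite add0r main.
Qed.

End Optimum.
End Cost.
End Dispatch.

(** * Partition of unity by marginal units *)
Section UnitDirection.
Context {R : realType} {K : nat} {P : dispatch R K}.
Hypothesis ht : t1 P < t2 P.
Local Notation T := (`[t1 P, t2 P]%classic : set R).
Context {x : 'I_K -> R -> R}.

Lemma direction0 (d : R) : direction P x d (fun _ _ => 0).
Proof.
by have [C0 D0] := C1_on0 ht; split=> // k t Tt _; split=> //; exact: D0.
Qed.

Lemma direction_lin (d c : R) phi psi :
  direction P x d phi -> direction P x d psi ->
  direction P x d (fun k t => phi k t + c * psi k t).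
Proof.
move=> [tphi dphi] [tpsi dpsi]; have [tz rz] := perturb_trajectory ht phi psi c tphi tpsi.
split=> // k t Tt sd; rewrite rz//.
by have [-> ->] := dphi k t Tt sd; have [-> ->] := dpsi k t Tt sd; rewrite mulr0 addr0.
Qed.

Lemma direction_sum (I : Type) (s : seq I) (d : R) (phi : I -> 'I_K -> R -> R) :
  (forall i, direction P x d (phi i)) ->
  direction P x d (fun k t => \sum_(i <- s) phi i k t).
Proof.
move=> dphi; elim: s => [|i s ih].
  rewrite (_ : (fun _ _ => _) = (fun _ _ => 0)); first exact: direction0.
  by apply/funext => k; apply/funext => t; rewrite big_nil.
rewrite (_ : (fun _ _ => _) =
  (fun k t => phi i k t + 1 * \sum_(j <- s) phi j k t)).
  exact: direction_lin.
by apply/funext => k; apply/funext => t; rewrite big_cons mul1r.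
Qed.

(** The bump moves unit k alone. A time of slack below d lies outside its support, where both the
    bump and its derivative vanish. *)
Lemma direction_spline (d h c : R) k : 0 < h ->
  (forall u, T u -> `|u - (c + 2 * h)| <= 2 * h -> d <= slack P x k u) ->
  direction P x d (fun j t => (j == k)%:R * spline h c t).
Proof.
move=> h0 hk; have [C D] := spline_C1 ht h c h0.
have Z j := C1_onZ ht _ (j == k)%:R C.
split=> [j|j t Tt]; first exact: (Z j).1.
rewrite /rate (Z j).2// D//.
have [->|_] := eqVneq j k; last by rewrite !mul0r.
move=> sd; rewrite !mul1r; apply: spline_outside => //.
have [tc|ct] := leP t c; [by left|right; rewrite leNgt; apply/negP => tc].
move: sd; rewrite ltNge hk//.
move: ct tc => /ltW ct /ltW tc; rewrite ler_norml; apply/andP; split; lra.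
Qed.

Context {y : R -> R}.
Hypothesis fx : feasible P y x.
Hypothesis hmarg : forall t, horizon P t -> exists k, marginal P x k t.

(** A Lebesgue number argument: near each time one marginal unit keeps a positive slack, and
    compactness gives a single e that serves as both radius and margin. *)
Lemma uniform_slack : exists2 e : R, 0 < e & forall t, T t -> exists k,
  forall u, T u -> `|u - t| <= e -> e <= slack P x k u.
Proof.
pose Q (e t : R) := exists k,
  forall u, T u -> `|u - t| <= e -> e <= slack P x k u.
have nQ : \forall e \near (0 : R)^'+, T `<=` Q e.
  have /compact_near_coveringP/near_covering_withinP H := @segment_compact R (t1 P) (t2 P).
  apply: (H R (0^'+) Q _) => t Tt.
  have [k mk] := hmarg t Tt.
  have sk := marginal_slack_gt0 y x k t fx Tt mk.
  have /within_continuousP cs := slack_continuous x k fx.1.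
  have sk2 : 0 < slack P x k t / 2 by rewrite divr_gt0.
  have [r r0 hr] := cs t Tt _ sk2.
  (* Points within e of v are then within r of t, where the slack has lost at most half of its value
     at t and still exceeds e. *)
  exists (ball t (r / 2), [set e | e < Num.min (r / 2) (slack P x k t / 2)]).
    split; first by apply: nbhsx_ballx; rewrite divr_gt0.
    by apply: nbhs_right_lt; rewrite lt_min !divr_gt0.
  move=> [v e] /= []; rewrite /ball/= lt_min => tv /andP[er es] Tv.
  exists k => u Tu uv; have : `|u - t| < r.
    rewrite -[u](subrK v) -addrA; apply: le_lt_trans (ler_normD _ _) _.
    by rewrite [`|v - t|]distrC; lra.
  by move=> /(hr u Tu); rewrite ler_norml => /andP[? _]; lra.
have [e [Qe e0]] := @filter_ex _ ((0 : R)^'+) _ _ (filterI nQ (nbhs_right_gt 0)).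
by exists e.
Qed.

(** Bumps centred at equally spaced times sum to 1 on the horizon; each is assigned to a unit with
    uniform slack on its support. *)
Lemma unit_direction : exists2 d : R, 0 < d &
  exists2 phi, direction P x d phi & forall t, T t -> \sum_k phi k t = 1.
Proof.
have [e e0 he] := uniform_slack; exists e => //.
pose L := t2 P - t1 P; have L0 : 0 < L by rewrite subr_gt0.
(* This makes the half-width 2h = L / n of the bumps at most e. *)
have [n nL] : exists n, L / e < n%:R.
  by exists (Num.bound (L / e)); apply: archi_boundP; rewrite divr_ge0// ltW.
have n0 : 0 < n%:R :> R by apply: le_lt_trans nL; rewrite divr_ge0// ltW.
pose h := L / (2 * n%:R).
have h0 : 0 < h by rewrite divr_gt0// mulr_gt0.
have hn : 2 * h * n%:R = L by rewrite /h; field; rewrite gt_eqF.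
have h2e : 2 * h <= e.
  by rewrite -(ler_pM2r n0) hn mulrC -ler_pdivrMr// ltW.
(* The shift by 2h centres bump i at t1 + 2hi. The n + 1 bumps, i = 0 to n, have centres from t1 to
   t2, so the sum is 1 at both endpoints too. *)
pose c i := t1 P - 2 * h + 2 * h * i%:R.
have cE i : c i + 2 * h = t1 P + 2 * h * i%:R by rewrite /c; ring.
have Tc (i : 'I_n.+1) : T (c i + 2 * h).
  have i0 : 0 <= 2 * h * i%:R by rewrite !mulr_ge0// ltW.
  have iL : 2 * h * i%:R <= L.
    have h20 : 0 <= 2 * h by rewrite mulr_ge0// ltW.
    have leqin : (i <= n)%N by rewrite -ltnS ltn_ord.
    by rewrite -hn; apply: ler_wpM2l => //; rewrite ler_nat.
  by rewrite /= in_itv/= cE; move: iL; rewrite /L => iL; apply/andP; split; lra.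
pose kk i := sval (cid (he _ (Tc i))).
exists (fun j t => \sum_(i < n.+1) (j == kk i)%:R * spline h (c i) t).
  apply: direction_sum => i; apply: direction_spline => // u Tu ur.
  by rewrite /kk; case: cid => k hk /=; apply: hk => //; exact: le_trans ur h2e.
move=> t; rewrite /= in_itv/= => /andP[at' tb].
rewrite exchange_big/= -[RHS](@spline_partition R h (t1 P - 2 * h) n.+1 t h0).
- apply: eq_bigr => i _; rewrite -mulr_suml (bigD1 (kk i))//= eqxx big1 ?addr0 ?mul1r//.
  by move=> j /negPf ->.
- by rewrite subrK.
- by rewrite -(natr1 n) mulrDr mulr1 hn /L; lra.
Qed.

End UnitDirection.

(** * The multiplier as marginal cost and as price *)

(** Stationarity along a bump of unit k around t makes g = D - lambda integrate to 0 against the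
    bump. If g t were nonzero, g would keep its sign on a small enough support, a contradiction. *)
Lemma price_eq_marginal_cost (R : realType) (K : nat) (P : dispatch R K)
    (y : R -> R) (x : 'I_K -> R -> R) (m : multipliers R K) :
  t1 P < t2 P -> (forall k, C1_cost (horizon P) (cost P k)) -> (1 <= K)%N ->
  C1_on (horizon P) y -> optimal_schedule P y x ->
  associated_multipliers P y x m ->
  forall t, horizon P t -> forall k, marginal P x k t ->
    lambda m t = derive1 (fun v => cost P k v t) (x k t).
Proof.
move=> ht hC hK hy hx hm t Tt k mk.
pose D u := derive1 (fun v => cost P k v u) (x k u).
have cD : {within horizon P, continuous D}.
  by apply: (marginal_cost_continuous (hC k)); have [] := trajectory_continuous x k hx.1.1.
have cl : {within horizon P, continuous (lambda m)} := lambda_continuous hm.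
have cg := within_continuousBf _ _ cD cl.
pose g u := D u - lambda m u.
apply/esym/eqP; rewrite -subr_eq0; apply/negPn/negP => g0.
have g20 : 0 < `|g t| / 2 by rewrite divr_gt0// normr_gt0.
have sk := marginal_slack_gt0 y x k t hx.1 Tt mk.
have sk2 : 0 < slack P x k t / 2 by rewrite divr_gt0.
have /within_continuousP cs := slack_continuous x k hx.1.1.
have [r r0 hr] := cs t Tt _ sk2.
move: (cg) => /within_continuousP /(_ t Tt _ g20) [r' r'0 hr'].
(* The half-width 2h stays below r, which secures the slack, and below r', which secures the sign of
   g. *)
pose h := Num.min r r' / 4.
have h0 : 0 < h by rewrite divr_gt0// lt_min r0.
have /andP[hr4 hr'4] : (4 * h <= r) && (4 * h <= r').
  by rewrite /h mulrC divfK// -le_min lexx.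
pose c := t - 2 * h.
have ch : c + 2 * h = t by rewrite /c subrK.
have dphi : direction P x (slack P x k t / 2)
    (fun j u => (j == k)%:R * spline h c u).
  apply: direction_spline => // u Tu; rewrite ch => ut.
  have /(hr u Tu) : `|u - t| < r by lra.
  by rewrite ler_norml => /andP[? _]; lra.
have cp : {within horizon P, continuous (spline h c)}.
  by apply: C1_on_continuous; have [] := spline_C1 ht h c h0.
have E1 : \sum_j \int[lebesgue_measure]_(u in horizon P)
      (derive1 (fun v => cost P j v u) (x j u) * ((j == k)%:R * spline h c u)) =
    \int[lebesgue_measure]_(u in horizon P) (D u * spline h c u).
  rewrite (bigD1 k)//= big1 ?addr0 => [|i /negPf ik].
    by apply: segment_integral_eq => u _; rewrite eqxx mul1r.
  by apply: segment_integral0 => u _; rewrite ik mul0r mulr0.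
have E2 : \int[lebesgue_measure]_(u in horizon P)
      ((\sum_j (j == k)%:R * spline h c u) * lambda m u) =
    \int[lebesgue_measure]_(u in horizon P) (lambda m u * spline h c u).
  apply: segment_integral_eq => u _.
  rewrite (bigD1 k)//= big1 ?addr0 => [|i /negPf ->]; last by rewrite mul0r.
  by rewrite eqxx mul1r mulrC.
have cDp := within_continuousM _ _ cD cp.
have clp := within_continuousM _ _ cl cp.
have cgp : {within horizon P, continuous (fun u => g u * spline h c u)}.
  exact: within_continuousM.
(* The constant factor g t makes the integrand nonnegative whichever sign g has near t. *)
have int0 : \int[lebesgue_measure]_(u in horizon P) (g t * (g u * spline h c u)) = 0.
  apply: etrans (segment_integralZ _ _ cgp) _.
  rewrite (_ : Rintegral _ _ _ = 0) ?mulr0//.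
  apply: (@etrans _ _ (\int[lebesgue_measure]_(u in horizon P)
      (D u * spline h c u - lambda m u * spline h c u))).
    by apply: segment_integral_eq => u _; rewrite /g mulrBl.
  apply: etrans (segment_integralB _ _ cDp clp) _; apply/eqP; rewrite subr_eq0.
  apply/eqP; apply: etrans (esym E1) (etrans _ E2).
  exact (stationarity ht hC hK hy hx hm _ _ sk2 dphi).
have sp1 : spline h c t = 1 by rewrite -ch spline_mid.
suff gg : g t * (g t * spline h c t) = 0.
  by move/eqP: gg; rewrite sp1 mulr1 mulf_eq0 orbb; apply/negP.
apply: (segment_integral_eq0 (fun u => g t * (g u * spline h c u)) ht _ _ int0 t Tt).
  by apply: within_continuousM => //; exact: within_continuous_cst.
move=> u Tu; have := spline_ge0 h c h0 u.
have [ut|ut] := leP `|u - t| (2 * h).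
  have /(hr' u Tu) : `|u - t| < r' by lra.
  rewrite -/(g u) -/(g t) mulrA => gu p0; rewrite mulr_ge0//.
  move: gu; case: (ltrgt0P (g t)) => gt gu.
  - by move: gu; rewrite ler_norml => /andP[? ?]; rewrite mulr_ge0//; lra.
  - by move: gu; rewrite ler_norml => /andP[? ?]; rewrite mulr_le0//; lra.
  - by rewrite gt mul0r.
have -> : spline h c u = 0.
  apply: (spline_outside h c h0 u _).1.
  have [ut'|ut'] := leP u t; [left|right].
    by move: ut; rewrite ler0_norm ?subr_le0// /c => /ltW; lra.
  by move: ut; rewrite gtr0_norm ?subr_gt0// /c => /ltW; lra.
by rewrite !mulr0.
Qed.

Theorem mainTheorem1 (R : realType) (K : nat) (P : dispatch R K) (y : R -> R)
    (x : 'I_K -> R -> R) (m : multipliers R K)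
    (hK : (1 <= K)%N)
    (ht : t1 P < t2 P)
    (hy : C1_on (horizon P) y)
    (hC : forall k, C1_cost (horizon P) (cost P k))
    (hx : optimal_schedule P y x)
    (hm : associated_multipliers P y x m)
    (hmarg : forall t, horizon P t -> exists k, marginal P x k t) :
  is_price P y (lambda m) /\
  forall t, horizon P t -> forall k, marginal P x k t ->
    lambda m t = derive1 (fun v => cost P k v t) (x k t).
Proof.
split.
  rewrite /is_price; set I := \int[lebesgue_measure]_(t in _) _.
  have V0 : shifted_value P y 0 = (total_cost P x)%:E.
    rewrite -(optimal_valueE _ _ hx) /shifted_value; congr optimal_value.
    by apply/funext => t; rewrite addr0.
  have [d d0 [phi dphi phi1]] := unit_direction ht hx.1 hmarg.
  have [r r0 hr] := perturb_feasible ht y x d phi d0 hx.1 dphi phi1.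
  have DI : \sum_k \int[lebesgue_measure]_(t in horizon P)
      (derive1 (fun v => cost P k v t) (x k t) * phi k t) = I.
    rewrite (stationarity ht hC hK hy hx hm d phi d0 dphi).
    by apply: segment_integral_eq => t Tt; rewrite phi1// mul1r.
  (* Weak duality bounds the value from below for every e, with no error term. *)
  have lower e : ((total_cost P x + e * I)%:E <= shifted_value P y e)%E.
    apply: le_ereal_inf_tmp => _ [z fz <-]; rewrite lee_fin.
    exact (weak_duality hC hK hy hx hm z e fz).
  have upper e : `|e| < r -> (shifted_value P y e <=
      (total_cost P (fun k t => (x k t + e * phi k t)%R))%:E)%E.
    by move=> er; apply: ereal_inf_lbound; eexists; [exact: hr e er|].
  (* The two real bounds exclude both infinite values, so the limit can be taken in the reals. *)
  have fin e : `|e| < r -> shifted_value P y e \is a fin_num.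
    move=> er; rewrite fin_numE; apply/andP; split; apply/eqP => E.
      by have := lower e; rewrite E leeNy_eq.
    by have := upper e er; rewrite E leye_eq.
  apply/fine_cvgP; split.
    exists r => //= e; rewrite /ball/= sub0r normrN => er _.
    by rewrite V0 -(fineK (fin e er)) -EFinB -EFinM.
  apply/cvgrPdist_le => e e0.
  have [r' r'0 hr'] :=
    total_cost_expansion ht hC hK hx phi e dphi.1 e0.
  exists (Num.min r r'); first by rewrite /= lt_min r0.
  move=> s /=; rewrite sub0r normrN lt_min => /andP[sr sr'] s0.
  (* Only the upper half of the expansion enters: with the lower bound it puts v - V - s * I between
     0 and e * |s|, where V is the optimal cost. Dividing by |s| covers both signs of s. *)
  have := hr' s sr'; rewrite DI ler_norml => /andP[_ h1].
  have := lower s; have := upper s sr; rewrite V0.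
  rewrite -(fineK (fin s sr)); set v := fine _; rewrite !lee_fin /= => h2 h3.
  have ns : 0 < `|s| by rewrite normr_gt0.
  rewrite -(ler_pM2r ns) -normrM mulrBl divfK// ler_norml.
  by apply/andP; split; lra.
exact: price_eq_marginal_cost hx hm.
Qed.
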